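(* Let $R_1,\dots,R_g\in M_d(\mathbb C)$ be a basis of a $g$-dimensional algebra $\mathcal R=\operatorname{span}\{R_1,\dots,R_g\}\subseteq M_d(\mathbb C)$ and let $\Xi=(\Xi_1,\dots,\Xi_g)\in M_g(\mathbb C)^g$ be its structure matrices, i.e. $R_kR_j=\sum_{s=1}^g(\Xi_j)_{k,s}R_s$ for all $1\le j,k\le g$. Let $C\in M_d(\mathbb C)$ be unitary and let $A=(A_1,\dots,A_g)\in M_d(\mathbb C)^g$ satisfy $R_j=(C-I)A_j$ for $1\le j\le g$ and $$A_kR_j=\sum_{s=1}^g(\Xi_j)_{k,s}A_s\qquad(1\le j,k\le g)$$ (that is, $(\mathcal D_A,\mathcal D_{CA})$ is a spectrahedral pair associated to $\mathcal R$). Then $\mathcal D_A$ is bianalytic to $\mathcal D_{CA}$, where $CA=(CA_1,\dots,CA_g)$, under the convexotonic map $$p(x)=x\,(I-\Lambda_\Xi(x))^{-1}$$ whose structure matrices are $\Xi$.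
   Context: For $A\in M_d(\mathbb C)^g$ and freely noncommuting variables $x=(x_1,\dots,x_g)$ put $\Lambda_A(x)=\sum_jA_jx_j$ and $L_A(x)=I_d+\Lambda_A(x)+\Lambda_A(x)^*$, evaluated at $X\in M_n(\mathbb C)^g$ by $\Lambda_A(X)=\sum_jA_j\otimes X_j$, $L_A(X)=I+\Lambda_A(X)+\Lambda_A(X)^*$. The free spectrahedron $\mathcal D_A$ is the sequence $(\mathcal D_A(n))_n$ with $\mathcal D_A(n)=\{X\in M_n(\mathbb C)^g: L_A(X)\succeq0\}$. A free function on a free set (closed under direct sums and unitary similarity) is a sequence of functions on the matrix levels respecting intertwinings: if $X\Gamma=\Gamma Y$ then $f(X)\Gamma=\Gamma f(Y)$. It is free analytic if its domain is levelwise open and it is analytic on each level. A free analytic mapping is a tuple $p=(p^1,\dots,p^{\tilde g})$ of free analytic functions; $p:\mathcal D\to\mathcal E$ means $\mathcal D$ is contained in the domain of $p$ and $p$ maps $\mathcal D$ into $\mathcal E$. $\mathcal D$ and $\mathcal E$ are bianalytic under $p$ if $p:\mathcal D\to\mathcal E$ and there is a free analytic mapping $q:\mathcal E\to\mathcal D$ such that $p\circ q$ and $q\circ p$ are the identity maps on $\mathcal E$ and $\mathcal D$ respectively. $x$ is viewed as a row vector, so $p(x)=x(I-\Lambda_\Xi(x))^{-1}$ has entries $p^i(x)=\sum_jx_j\big((I-\Lambda_\Xi(x))^{-1}\big)_{j,i}$. A tuple $\Xi\in M_g(\mathbb C)^g$ is convexotonic if $\Xi_k\Xi_j=\sum_s(\Xi_j)_{k,s}\Xi_s$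 for all $j,k$ and then $p$ is called a convexotonic map.
   Formalization: The claim fails for closed D_A when p has a pole on the boundary (d=g=1, A=1, C=-1, x=-1/2). Proved instead: p is bianalytic between D_A and D_CA minus the points where p or its inverse is undefined, between their interiors, and between D_A and D_CA themselves if both are levelwise bounded. *)

(* Defs.v *)
From HB Require Import structures.
From mathcomp Require Import all_boot all_order all_algebra.
From mathcomp Require Import spectral.
From mathcomp Require Import complex mxtens.
From mathcomp Require Import all_classical reals topology normedtype sequences.

Set Implicit Arguments.
Unset Strict Implicit.
Unset Printing Implicit Defensive.

Import Order.TTheory GRing.Theory Num.Theory.
Import numFieldTopology.Exports numFieldNormedType.Exports.

Local Open Scope classical_set_scope.
Local Open Scope sesquilinear_scope.
Local Open Scope complex_scope.
Local Open Scope ring_scope.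

(* The field of complex numbers F[i], packaged so that all its structures are
   inferred from numClosedFieldType. *)
Definition cplx (F : realType) : numClosedFieldType := F[i].

Section FreeAnalysis.
Variable F : realType.

Local Notation C := (cplx F).

Definition mtuple (g n : nat) : Type := 'I_g -> 'M[C]_n.

Definition levels (g : nat) : Type := forall n, set (mtuple g n).

Definition tadd g n (X H : mtuple g n) : mtuple g n := fun j => X j + H j.

Definition tscale g n (c : C) (X : mtuple g n) : mtuple g n := fun j => c *: X j.

Definition tdsum g m n (X : mtuple g m) (Y : mtuple g n) : mtuple g (m + n) :=
  fun j => block_mx (X j) 0 0 (Y j).

(* Here [< r] is the order of C, so 0 < r forces r to be real. *)
Definition tsmall g n (r : C) (H : mtuple g n) : Prop :=
  forall j a b, `|H j a b| < r.

Definition free_set g (D : levels g) : Prop :=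
  (forall m n (X : mtuple g m) (Y : mtuple g n),
     D m X -> D n Y -> D (m + n)%N (tdsum X Y)) /\
  (forall n (U : 'M[C]_n) (X : mtuple g n),
     U \is unitarymx -> D n X -> D n (fun j => U^t* *m X j *m U)).

Definition levelwise_open g (D : levels g) : Prop :=
  forall n (X : mtuple g n), D n X ->
    exists2 r : C, 0 < r & forall H, tsmall r H -> D n (tadd X H).

Definition levelwise_bounded g (D : levels g) : Prop :=
  forall n, exists r : C, forall X : mtuple g n, D n X -> tsmall r X.

Definition multilinear g n k (a : ('I_k -> mtuple g n) -> 'M[C]_n) : Prop :=
  forall (h : 'I_k -> mtuple g n) (i : 'I_k) (c : C) (u v : mtuple g n),
    let upd x := @dfwith 'I_k (fun=> mtuple g n) h i x in
    a (upd (tadd (tscale c u) v)) = c *: a (upd u) + a (upd v).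

(* Local expansion in a power series f (X + H) = \sum_k a_k(H, ..., H).  The
   uniform bound on the a_k makes the series converge absolutely and locally
   uniformly on the polydisc of radius r. *)
Definition analytic_at g n (f : mtuple g n -> 'M[C]_n) (X : mtuple g n) : Prop :=
  exists (r M : C) (a : forall k, ('I_k -> mtuple g n) -> 'M[C]_n),
    [/\ 0 < r,
        forall k, multilinear (@a k),
        forall k (h : 'I_k -> mtuple g n), (forall i, tsmall r (h i)) ->
          forall u v, `|a k h u v| <= M
      & forall H, tsmall r H -> forall u v,
          (fun N : nat => \sum_(k < N) a k (fun=> H) u v) @ \oo
            --> f (tadd X H) u v].

Definition free_map (g h : nat) : Type := forall n, mtuple g n -> mtuple h n.

Definition respects_intertwinings g h (D : levels g) (f : free_map g h) : Prop :=
  forall m n (X : mtuple g m) (Y : mtuple g n) (G : 'M[C]_(m, n)),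
    D m X -> D n Y -> (forall j, X j *m G = G *m Y j) ->
    forall i, f m X i *m G = G *m f n Y i.

(* Free maps are total functions in Rocq; only the values on the domain [dom]
   are constrained. *)
Definition free_analytic g h (dom : levels g) (f : free_map g h) : Prop :=
  [/\ free_set dom, levelwise_open dom, respects_intertwinings dom f
    & forall n (X : mtuple g n), dom n X ->
        forall i, analytic_at (fun Y => f n Y i) X].

Definition maps_into g h (dom : levels g) (f : free_map g h)
    (D : levels g) (E : levels h) : Prop :=
  forall n (X : mtuple g n), D n X -> dom n X /\ E n (f n X).

Definition bianalytic_under g h (D : levels g) (E : levels h)
    (dom : levels g) (p : free_map g h) : Prop :=
  [/\ free_analytic dom p, maps_into dom p D E
    & exists (domq : levels h) (q : free_map h g),
        [/\ free_analytic domq q, maps_into domq q E D,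
            forall n (Y : mtuple h n), E n Y -> p n (q n Y) = Y
          & forall n (X : mtuple g n), D n X -> q n (p n X) = X]].

Definition Lambda g d n (A : mtuple g d) (X : mtuple g n) : 'M[C]_(d * n) :=
  \sum_j A j *t X j.

Definition Lpencil g d n (A : mtuple g d) (X : mtuple g n) : 'M[C]_(d * n) :=
  1%:M + Lambda A X + (Lambda A X)^t*.

(* In the order of C, 0 <= z means that z is a nonnegative real, so the two
   conditions below force M to be Hermitian. *)
Definition psdmx n (M : 'M[C]_n) : Prop :=
  forall v : 'cV[C]_n, 0 <= (v^t* *m M *m v) 0 0.

Definition posdefmx n (M : 'M[C]_n) : Prop :=
  forall v : 'cV[C]_n, v != 0 -> 0 < (v^t* *m M *m v) 0 0.

Definition free_spectrahedron g d (A : mtuple g d) : levels g :=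
  fun n => [set X | psdmx (Lpencil A X)].

(* The levelwise topological interior of [free_spectrahedron A]: if X is an
   interior point then (1 + e) X is in the spectrahedron for some e > 0, and
   (1 + e) L_A(X) = e I + L_A((1 + e) X). *)
Definition free_spectrahedron_int g d (A : mtuple g d) : levels g :=
  fun n => [set X | posdefmx (Lpencil A X)].

Definition convexotonic g (Xi : mtuple g g) : Prop :=
  forall j k, Xi k *m Xi j = \sum_s Xi j k s *: Xi s.

Definition mxblk g n (M : 'M[C]_(g * n)) (j i : 'I_g) : 'M[C]_n :=
  \matrix_(a, b) M (mxtens_index (j, a)) (mxtens_index (i, b)).

Definition cvx_dom g (Xi : mtuple g g) : levels g :=
  fun n => [set X | 1%:M - Lambda Xi X \in unitmx].

(* The row x (I - Lambda_Xi(x))^-1. *)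
Definition cvx_map g (Xi : mtuple g g) : free_map g g :=
  fun n X i => \sum_j X j *m mxblk (invmx (1%:M - Lambda Xi X)) j i.

Definition levelsI g (D E : levels g) : levels g := fun n => D n `&` E n.

End FreeAnalysis.

(* Main.v *)
Require Import Defs.
From mathcomp Require Import all_boot all_order all_algebra.
From mathcomp Require Import spectral.
From mathcomp Require Import complex mxtens.
From mathcomp Require Import all_classical reals topology normedtype sequences.
Import Order.TTheory GRing.Theory Num.Theory.
Import numFieldTopology.Exports numFieldNormedType.Exports.
Local Open Scope ring_scope.

(** For rows y and x of matrices put (y o x)_s = sum_kj (Xi_j)_{k,s} y_k x_j;
    this is the product that the multiplication rule R_k R_j = sum_s
    (Xi_j)_{k,s} R_s induces on coefficient rows.  The row p = p(x) is the
    solution of p = x + p o x: it is the quasi-inverse of x, and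
    -p(-x) = x (I + Lambda_Xi(x))^-1 undoes it.

    For every tuple B with B_k R_j = sum_s (Xi_j)_{k,s} B_s one has
    Lambda_B(y) Lambda_R(x) = Lambda_B(y o x) ([Lambda_circ]), hence
    Lambda_B(p(x)) (I - Lambda_R(x)) = Lambda_B(x) ([Lambda_quasi]).  This
    applies to B = A and B = CA, to B = R, and to B = R = Xi once Xi is known
    to be convexotonic, which is the associativity of the algebra
    ([spair_convexotonic]).

    Let T = Lambda_A(x), Z = Lambda_{CA}(x) and N = I - Lambda_R(x)
    = I - (Z - T).  Since C is unitary, Z and T have the same Gram matrix, so
    that, with S = Lambda_{CA}(p(x)) = Z N^-1, the matrix L_{CA}(p(x)) is
    congruent through N to L_A(x) ([pencil_congr], [spair_pencil]).  Thus p
    carries D_A into D_{CA} wherever it is defined.  Exchanging A with CA, C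
    with its adjoint, R with -R and Xi with -Xi gives again a spectrahedral
    pair ([spairC]), and so the same argument applies to the inverse of p.

    It remains to find where p is defined.  Linear independence of the R_j
    makes invertibility of I - Lambda_R(x) sufficient ([spair_cvx_dom]).  A
    vector in the kernel of N is a null vector of the form L_A(x), which
    settles the interior of D_A ([posdef_cvx_dom]).  On the boundary, move to
    t x with t < 1: the resolvents (I - t Lambda_R(x))^-1
    = I + Lambda_R(p(t x)) stay bounded as t tends to 1 if D_{CA} is bounded,
    so I - Lambda_R(x) is invertible too ([bounded_cvx_dom]).

    That p is free analytic comes from the equation p = x + p o x, which
    passes to direct sums and intertwiners, and from a Neumann series
    ([cvx_map_analytic]). *)

Set Implicit Arguments.
Unset Strict Implicit.
Unset Printing Implicit Defensive.

(** * Tensor products of matrices *)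

Section Tensor.
Variable K : comPzRingType.

Lemma tensmxDr m n p q (A : 'M[K]_(m, n)) (B B' : 'M[K]_(p, q)) :
  A *t (B + B') = A *t B + A *t B'.
Proof. by apply/matrixP=> i j; rewrite !mxE mulrDr. Qed.

Lemma tensmxZl m n p q c (A : 'M[K]_(m, n)) (B : 'M[K]_(p, q)) :
  (c *: A) *t B = c *: (A *t B).
Proof. by apply/matrixP=> i j; rewrite !mxE mulrA. Qed.

Lemma tensmxZr m n p q c (A : 'M[K]_(m, n)) (B : 'M[K]_(p, q)) :
  A *t (c *: B) = c *: (A *t B).
Proof. by apply/matrixP=> i j; rewrite !mxE mulrCA. Qed.

Lemma tensmx_suml (I : finType) m n p q (A : I -> 'M[K]_(m, n))
  (B : 'M[K]_(p, q)) : (\sum_i A i) *t B = \sum_i (A i *t B).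
Proof.
apply/matrixP=> i j; rewrite !mxE !summxE big_distrl.
by apply: eq_bigr => k _; rewrite mxE.
Qed.

Lemma tensmx_sumr (I : finType) m n p q (A : 'M[K]_(m, n))
  (B : I -> 'M[K]_(p, q)) : A *t (\sum_i B i) = \sum_i (A *t B i).
Proof.
apply/matrixP=> i j; rewrite !mxE !summxE big_distrr.
by apply: eq_bigr => k _; rewrite mxE.
Qed.

Lemma tensmx11 m n : (1%:M : 'M[K]_m) *t (1%:M : 'M[K]_n) = 1%:M.
Proof.
apply/matrixP=> u v; rewrite !mxE -natrM mulnb.
by rewrite -(inj_eq (can_inj (@mxtens_unindexK m n)) u v).
Qed.

End Tensor.

Lemma sum_tens (V : nmodType) m n (f : 'I_(m * n) -> V) :
  \sum_u f u = \sum_i \sum_j f (mxtens_index (i, j)).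
Proof.
rewrite pair_bigA (reindex (@mxtens_index m n)) /=.
  by apply: eq_bigr => -[].
exists (@mxtens_unindex m n) => u _; [exact: mxtens_indexK|].
exact: mxtens_unindexK.
Qed.

Lemma sum_block_diag (V : pzRingType) (I : finType) m n (A : I -> 'M[V]_m)
    (B : I -> 'M[V]_n) :
  \sum_i block_mx (A i) 0 0 (B i) = block_mx (\sum_i A i) 0 0 (\sum_i B i).
Proof.
apply: (big_ind3 (fun M A' B' => M = block_mx A' 0 0 B')) => //.
  by apply/matrixP=> i j; rewrite !mxE; case: splitP => ? _; rewrite !mxE;
    case: splitP => ? _; rewrite !mxE.
by move=> _ A1 B1 _ A2 B2 -> ->; rewrite add_block_mx !addr0.
Qed.

Lemma kermx_unitmx (K : fieldType) n (M : 'M[K]_n) :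
  (forall v : 'rV_n, v *m M = 0 -> v = 0) -> M \in unitmx.
Proof. by move/inj_row_free; rewrite row_free_unit. Qed.

(** * The product on rows induced by the structure matrices *)

Section Circ.
Variable F : realType.
Local Notation C := (cplx F).

(** The rows [y] are rectangular, so that the rows X G and G Y met in an
    intertwining relation X G = G Y are covered. *)
Definition circ g m n (Xi : mtuple F g g) (y : 'I_g -> 'M[C]_(m, n))
    (X : mtuple F g n) : 'I_g -> 'M[C]_(m, n) :=
  fun s => \sum_k \sum_j Xi j k s *: (y k *m X j).

Definition rowblk g m n (y : 'I_g -> 'M[C]_(m, n)) : 'M[C]_(m, g * n) :=
  \matrix_(a, u) y (mxtens_unindex u).1 a (mxtens_unindex u).2.

Definition blk g m n (V : 'M[C]_(m, g * n)) (s : 'I_g) : 'M[C]_(m, n) :=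
  \matrix_(a, b) V a (mxtens_index (s, b)).

Lemma rowblkK g m n (y : 'I_g -> 'M[C]_(m, n)) s : blk (rowblk y) s = y s.
Proof. by apply/matrixP=> a b; rewrite !mxE mxtens_indexK. Qed.

Lemma blkK g m n (V : 'M[C]_(m, g * n)) : rowblk (blk V) = V.
Proof.
by apply/matrixP=> a u; rewrite !mxE -surjective_pairing mxtens_unindexK.
Qed.

Lemma eq_rowblk g m n (y z : 'I_g -> 'M[C]_(m, n)) :
  y =1 z -> rowblk y = rowblk z.
Proof. by move=> e; apply/matrixP=> a u; rewrite !mxE e. Qed.

Lemma rowblk_mul g m n (Xi : mtuple F g g) (y : 'I_g -> 'M[C]_(m, n)) X :
  rowblk y *m Lambda Xi X = rowblk (circ Xi y X).
Proof.
apply/matrixP=> a u; case: (mxtens_indexP u) => s b.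
rewrite !mxE sum_tens mxtens_indexK /= summxE; apply: eq_bigr => k _.
rewrite summxE.
under [RHS]eq_bigr do rewrite !mxE big_distrr.
rewrite exchange_big; apply: eq_bigr => c _.
rewrite summxE big_distrr; apply: eq_bigr => j _.
by rewrite /= tensmxE !mxE mxtens_indexK /= mulrCA.
Qed.

Lemma mul_rowblk g l m n (G : 'M[C]_(l, m)) (y : 'I_g -> 'M[C]_(m, n)) :
  G *m rowblk y = rowblk (fun s => G *m y s).
Proof. by apply/matrixP=> a u; rewrite !mxE; apply: eq_bigr => b _; rewrite !mxE. Qed.

Lemma rowblk_quasi g m n (Xi : mtuple F g g) (x y : 'I_g -> 'M[C]_(m, n)) X :
    (forall s, y s = x s + circ Xi y X s) ->
  rowblk y *m (1%:M - Lambda Xi X) = rowblk x.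
Proof.
move=> e; rewrite mulmxBr mulmx1 rowblk_mul; apply/matrixP=> a u.
by rewrite !mxE e !mxE addrK.
Qed.

Lemma cvx_mapE g (Xi : mtuple F g g) n (X : mtuple F g n) s :
  cvx_map Xi X s = blk (rowblk X *m invmx (1%:M - Lambda Xi X)) s.
Proof.
apply/matrixP=> a b; rewrite summxE !mxE sum_tens; apply: eq_bigr => j _.
by rewrite !mxE; apply: eq_bigr => c _; rewrite !mxE mxtens_indexK.
Qed.

Lemma rowblk_cvx_map g (Xi : mtuple F g g) n (X : mtuple F g n) :
  rowblk (cvx_map Xi X) = rowblk X *m invmx (1%:M - Lambda Xi X).
Proof. by rewrite (eq_rowblk (cvx_mapE Xi X)) blkK. Qed.

(** Together with [cvx_map_uniq] this replaces the block formula for the map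
    by an equation in which the blocks are multiplied as matrices of size n. *)
Lemma cvx_map_circ g (Xi : mtuple F g g) n (X : mtuple F g n) s :
  cvx_dom Xi X -> cvx_map Xi X s = X s + circ Xi (cvx_map Xi X) X s.
Proof.
move=> dX; rewrite -(rowblkK (circ _ _ _)) -rowblk_mul.
have := mulmxKV dX (rowblk X); rewrite -rowblk_cvx_map mulmxBr mulmx1.
move=> /(congr1 (fun V => blk V s)); rewrite rowblkK => <-.
by apply/matrixP=> a b; rewrite !mxE subrK mxtens_indexK.
Qed.

Lemma cvx_map_uniq g (Xi : mtuple F g g) n (X : mtuple F g n) y :
  cvx_dom Xi X -> (forall s, y s = X s + circ Xi y X s) ->
  forall s, cvx_map Xi X s = y s.
Proof.
move=> dX e s; rewrite cvx_mapE -[RHS]rowblkK.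
by rewrite -(rowblk_quasi e) mulmxK.
Qed.

(** The coefficients A_k R_j of the product expand along the module relation,
    which is the one defining [circ] on the arguments. *)
Lemma Lambda_circ g d n (Xi : mtuple F g g) (B R : mtuple F g d)
    (y X : mtuple F g n) :
    (forall j k, B k *m R j = \sum_s Xi j k s *: B s) ->
  Lambda B y *m Lambda R X = Lambda B (circ Xi y X).
Proof.
move=> BR; rewrite /Lambda mulmx_suml.
under eq_bigr do rewrite mulmx_sumr.
under eq_bigr do under eq_bigr do rewrite tensmx_mul BR tensmx_suml.
under [RHS]eq_bigr do (rewrite tensmx_sumr;
  under eq_bigr do rewrite tensmx_sumr).
rewrite [RHS]exchange_big; apply: eq_bigr => k _.
rewrite [RHS]exchange_big; apply: eq_bigr => j _.
by apply: eq_bigr => s _; rewrite tensmxZl tensmxZr.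
Qed.

Lemma LambdaD g d n (B : mtuple F g d) (X Y : mtuple F g n) :
  Lambda B (tadd X Y) = Lambda B X + Lambda B Y.
Proof.
by rewrite -big_split; apply: eq_bigr => j _; apply: tensmxDr.
Qed.

Lemma LambdaZ g d n (B : mtuple F g d) c (X : mtuple F g n) :
  Lambda B (tscale c X) = c *: Lambda B X.
Proof. by rewrite scaler_sumr; apply: eq_bigr => j _; rewrite tensmxZr. Qed.

Lemma eq_Lambda g d n (B B' : mtuple F g d) (X X' : mtuple F g n) :
  B =1 B' -> X =1 X' -> Lambda B X = Lambda B' X'.
Proof. by move=> e e'; apply: eq_bigr => j _; rewrite e e'. Qed.

Lemma Lambda_quasi g d n (Xi : mtuple F g g) (B R : mtuple F g d)
    (y X : mtuple F g n) :
    (forall j k, B k *m R j = \sum_s Xi j k s *: B s) ->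
    (forall s, y s = X s + circ Xi y X s) ->
  Lambda B y *m (1%:M - Lambda R X) = Lambda B X.
Proof.
move=> BR e; rewrite mulmxBr mulmx1 (Lambda_circ _ _ BR).
by rewrite [in LHS](eq_Lambda (X' := tadd X (circ Xi y X)) (frefl B) e) LambdaD addrK.
Qed.

Lemma quasi_inverse g d n (Xi : mtuple F g g) (R : mtuple F g d)
    (y X : mtuple F g n) :
    (forall j k, R k *m R j = \sum_s Xi j k s *: R s) ->
    (forall s, y s = X s + circ Xi y X s) ->
  (1%:M + Lambda R y) *m (1%:M - Lambda R X) = 1%:M.
Proof. by move=> RR e; rewrite mulmxDl mul1mx (Lambda_quasi RR e) subrK. Qed.

(** For convexotonic Xi a solution of the quasi-inverse equation provides the
    inverse I + Lambda_Xi(y) of I - Lambda_Xi(X); this makes membership in the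
    domain a condition on the levels that is stable under direct sums and
    unitary similarity. *)
Lemma cvx_dom_quasi g n (Xi : mtuple F g g) (y X : mtuple F g n) :
    convexotonic Xi -> (forall s, y s = X s + circ Xi y X s) -> cvx_dom Xi X.
Proof. by move=> XX e; case/mulmx1_unit: (quasi_inverse XX e). Qed.

Lemma convexotonicN g (Xi : mtuple F g g) :
  convexotonic Xi -> convexotonic (fun j => - Xi j).
Proof.
move=> XX j k; rewrite mulNmx mulmxN opprK XX.
by apply: eq_bigr => s _; rewrite mxE scaleNr scalerN opprK.
Qed.

Lemma circN g m n (Xi : mtuple F g g) (y : 'I_g -> 'M[C]_(m, n)) X s :
  circ (fun j => - Xi j) y X s = - circ Xi y X s.
Proof.
rewrite /circ -sumrN; apply: eq_bigr => k _; rewrite -sumrN.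
by apply: eq_bigr => j _; rewrite mxE scaleNr.
Qed.

Lemma LambdaNl g d n (B : mtuple F g d) (X : mtuple F g n) :
  Lambda (fun j => - B j) X = - Lambda B X.
Proof. by rewrite -sumrN; apply: eq_bigr => j _; rewrite -scaleN1r tensmxZl scaleN1r. Qed.

Section Inverse.
Variables (g n : nat) (Xi : mtuple F g g) (X : mtuple F g n).
Hypotheses (XX : convexotonic Xi) (dX : cvx_dom Xi X).
Let Y := cvx_map Xi X.

Let inv1 : (1%:M - Lambda Xi X) *m (1%:M + Lambda Xi Y) = 1%:M.
Proof.
by apply: mulmx1C; apply: (quasi_inverse XX) => s; apply: cvx_map_circ.
Qed.

Let rowY : rowblk Y *m (1%:M - Lambda Xi X) = rowblk X.
Proof. by rewrite rowblk_cvx_map mulmxKV. Qed.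

Lemma cvx_map_dom : cvx_dom (fun j => - Xi j) Y.
Proof. by rewrite /cvx_dom /= LambdaNl opprK; case/mulmx1_unit: inv1. Qed.

(** With Y = p(X), the two inverse matrices I - Lambda_Xi(X) and
    I + Lambda_Xi(Y) commute, so Y = X + Y o X gives Y = X + X o Y as well. *)
Lemma cvx_mapK s : cvx_map (fun j => - Xi j) Y s = X s.
Proof.
apply: cvx_map_uniq; first exact: cvx_map_dom.
move=> {}s; rewrite circN -(rowblkK (circ _ _ _)) -rowblk_mul.
have := rowY => /(congr1 (mulmxr (1%:M + Lambda Xi Y))) /=.
rewrite -mulmxA inv1 mulmx1 mulmxDr mulmx1.
move=> /(congr1 (fun V => blk V s)); rewrite rowblkK => ->.
by apply/matrixP=> a b; rewrite !mxE addrK mxtens_indexK.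
Qed.

End Inverse.

End Circ.

(** * The sum of the moduli of the entries, a submultiplicative norm *)

Section SumNorm.
Variable K : numFieldType.

Definition sumnorm m n (M : 'M[K]_(m, n)) : K := \sum_u \sum_v `|M u v|.

Lemma sumnorm_ge0 m n (M : 'M[K]_(m, n)) : 0 <= sumnorm M.
Proof. by apply: sumr_ge0 => u _; apply: sumr_ge0 => v _. Qed.
Hint Resolve sumnorm_ge0 : core.

Lemma ler_entry_sumnorm m n (M : 'M[K]_(m, n)) u v : `|M u v| <= sumnorm M.
Proof.
rewrite /sumnorm (bigD1 u) //= (bigD1 v) //= -addrA lerDl addr_ge0 //.
  exact: sumr_ge0.
by apply: sumr_ge0 => u' _; apply: sumr_ge0.
Qed.

Lemma sumnorm0_eq0 m n (M : 'M[K]_(m, n)) : sumnorm M <= 0 -> M = 0.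
Proof.
move=> M0; apply/matrixP=> u v; rewrite mxE; apply/normr0_eq0/le_anti.
by rewrite normr_ge0 (le_trans (ler_entry_sumnorm M u v) M0).
Qed.

Lemma sumnormZ m n c (M : 'M[K]_(m, n)) : sumnorm (c *: M) = `|c| * sumnorm M.
Proof.
rewrite mulr_sumr; apply: eq_bigr => u _; rewrite mulr_sumr.
by apply: eq_bigr => v _; rewrite mxE normrM.
Qed.

Lemma ler_sumnormD m n (M N : 'M[K]_(m, n)) :
  sumnorm (M + N) <= sumnorm M + sumnorm N.
Proof.
rewrite -big_split; apply: ler_sum => u _; rewrite -big_split.
by apply: ler_sum => v _; rewrite mxE ler_normD.
Qed.

Lemma ler_sumnorm_sum (I : finType) m n (M : I -> 'M[K]_(m, n)) :
  sumnorm (\sum_i M i) <= \sum_i sumnorm (M i).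
Proof.
apply: (big_ind2 (fun A b => sumnorm A <= b)) => //.
  by rewrite -(scale0r 0) sumnormZ normr0 mul0r.
by move=> A a B b Aa Bb; apply: (le_trans (ler_sumnormD _ _)); apply: lerD.
Qed.

Lemma ler_sumnormM m n p (M : 'M[K]_(m, n)) (N : 'M[K]_(n, p)) :
  sumnorm (M *m N) <= sumnorm M * sumnorm N.
Proof.
rewrite [sumnorm M]/sumnorm mulr_suml; apply: ler_sum => u _.
apply: (@le_trans _ _ (\sum_w \sum_v `|M u w| * `|N w v|)).
  rewrite exchange_big; apply: ler_sum => v _.
  rewrite mxE (le_trans (ler_norm_sum _ _ _)) //.
  by apply: ler_sum => w _; rewrite normrM.
rewrite mulr_suml; apply: ler_sum => w _; rewrite -mulr_sumr ler_wpM2l //.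
rewrite /sumnorm [leRHS](bigD1 w) //= lerDl.
by apply: sumr_ge0 => w' _; apply: sumr_ge0.
Qed.

Lemma sumnorm_tens m n p q (A : 'M[K]_(m, n)) (B : 'M[K]_(p, q)) :
  sumnorm (A *t B) = sumnorm A * sumnorm B.
Proof.
rewrite /sumnorm sum_tens mulr_suml; apply: eq_bigr => a _.
rewrite mulr_sumr; apply: eq_bigr => b _; rewrite sum_tens mulr_suml.
apply: eq_bigr => c _; rewrite mulr_sumr; apply: eq_bigr => e _.
by rewrite tensmxE normrM.
Qed.

Lemma contract_fixed m n (v : 'M[K]_(m, n)) (M : 'M[K]_n) :
  sumnorm M <= 2^-1 -> v = v *m M -> v = 0.
Proof.
move=> M2 e; apply: sumnorm0_eq0.
have : sumnorm v <= sumnorm v * 2^-1.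
  by rewrite {1}e (le_trans (ler_sumnormM _ _)) // ler_wpM2l.
by rewrite ler_pdivlMr // mulrDr mulr1 gerDl.
Qed.

Lemma ler_sumnorm_prod m n k (z : 'M[K]_(m, n)) (M : 'I_k -> 'M[K]_n) :
  (forall i, sumnorm (M i) <= 1) ->
  sumnorm (z *m \prod_i M i) <= sumnorm z.
Proof.
elim: k => [|k IH] in z M * => M1; first by rewrite big_ord0 mulmx1.
rewrite big_ord_recl mulmxA (le_trans (IH _ _ _)) //.
by rewrite (le_trans (ler_sumnormM _ _)) // ler_piMr.
Qed.

Lemma ler_sumnorm_exp m n k (z : 'M[K]_(m, n)) (M : 'M[K]_n) :
  sumnorm M <= 2^-1 -> sumnorm (z *m M ^+ k) <= sumnorm z / 2 ^+ k.
Proof.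
move=> M2; elim: k => [|k IH]; first by rewrite !expr0 mulmx1 divr1.
rewrite exprSr mulmxA (le_trans (ler_sumnormM _ _)) //.
by rewrite exprSr invfM mulrA ler_pM.
Qed.

End SumNorm.
#[local] Hint Extern 0 (is_true (_ <= sumnorm _)) => exact: sumnorm_ge0 : core.

(** * Local power series expansion *)

Section Analytic.
Local Open Scope classical_set_scope.
Variable F : realType.
Local Notation C := (cplx F).

(** In the order of the complex numbers a nonnegative number is real, so the
    archimedean property of the reals applies. *)
Lemma cplx_archi (x : C) : 0 <= x -> exists N : nat, x <= N%:R.
Proof.
move=> x0; have /complex_realP [y xy] : x \is Num.real by exact: ger0_real.
exists (Num.bound y); rewrite xy -(rmorph_nat (real_complex F)) lecR ltW //.
by apply: archi_boundP; rewrite -lecR -xy.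
Qed.

Lemma cvg_geometric_error (u : nat -> C) (l b : C) :
  (forall m, `|l - u m.+1| <= b / 2 ^+ m) -> u @ \oo --> l.
Proof.
move=> ub; apply/cvgrPdist_le => e e0.
have b0 : 0 <= b by have := ub 0%N; rewrite expr0 divr1; exact: le_trans.
have [N bN] : exists N : nat, b / e <= N%:R.
  by apply: cplx_archi; rewrite divr_ge0 // ltW.
exists N.+1 => // -[//|m] /= Nm; apply: (le_trans (ub m)).
rewrite ler_pdivrMr ?exprn_gt0 // mulrC -ler_pdivrMr //.
rewrite (le_trans bN) // -natrX ler_nat (leq_trans (Nm : (N <= m)%N)) //.
exact/ltnW/ltn_expl.
Qed.

Lemma tsmall_sumnorm g n (r : C) (H : mtuple F g n) j :
  tsmall r H -> sumnorm (H j) <= (n * n)%:R * `|r|.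
Proof.
move=> Hr; apply: (@le_trans _ _ (\sum_(u < n) \sum_(v < n) `|r|)).
  apply: ler_sum => u _; apply: ler_sum => v _; have := Hr j u v => rH.
  by rewrite [leRHS]ger0_norm ltW // (le_lt_trans _ rH).
by rewrite !sumr_const !card_ord mulr_natl mulrnA.
Qed.

Lemma ler_sumnorm_Lambda g d n (B : mtuple F g d) (r : C) (H : mtuple F g n) :
  tsmall r H ->
  sumnorm (Lambda B H) <= (\sum_j sumnorm (B j)) * ((n * n)%:R * `|r|).
Proof.
move=> Hr; apply: (le_trans (ler_sumnorm_sum _)).
rewrite mulr_suml; apply: ler_sum => j _; rewrite sumnorm_tens ler_wpM2l //.
exact: tsmall_sumnorm.
Qed.

Lemma sumnorm_rowblk g m n (y : 'I_g -> 'M[C]_(m, n)) :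
  sumnorm (rowblk y) = \sum_j sumnorm (y j).
Proof.
rewrite /sumnorm [RHS]exchange_big; apply: eq_bigr => a _.
rewrite sum_tens; apply: eq_bigr => j _; apply: eq_bigr => b _.
by rewrite mxE mxtens_indexK.
Qed.

Lemma ler_sumnorm_rowblk g n (r : C) (H : mtuple F g n) :
  tsmall r H -> sumnorm (rowblk H) <= g%:R * ((n * n)%:R * `|r|).
Proof.
move=> Hr; rewrite sumnorm_rowblk mulr_natl -[g in leRHS]card_ord -sumr_const.
by apply: ler_sum => j _; apply: tsmall_sumnorm.
Qed.

Section Multilinear.
Variables g n : nat.

(** The condition that [multilinear] puts on each argument. *)
Definition tlinear p q (l : mtuple F g n -> 'M[C]_(p, q)) :=
  forall c u v, l (tadd (tscale c u) v) = c *: l u + l v.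

(** [multilinear] for values of any shape: the factors of the power series
    terms are square of size g n or rectangular, and only the final blocks are
    square of size n. *)
Definition mlin p q k (a : ('I_k -> mtuple F g n) -> 'M[C]_(p, q)) : Prop :=
  forall (h : 'I_k -> mtuple F g n) (i : 'I_k) (c : C) (u v : mtuple F g n),
    let upd x := @dfwith 'I_k (fun=> mtuple F g n) h i x in
    a (upd (tadd (tscale c u) v)) = c *: a (upd u) + a (upd v).

Lemma tlinear_Lambda d (B : mtuple F g d) : tlinear (@Lambda F g d n B).
Proof. by move=> c u v; rewrite LambdaD LambdaZ. Qed.

Lemma tlinear_rowblk : tlinear (@rowblk F g n n).
Proof. by move=> c u v; apply/matrixP=> a w; rewrite !mxE. Qed.

Lemma tlinear_add p q (l l' : mtuple F g n -> 'M[C]_(p, q)) :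
  tlinear l -> tlinear l' -> tlinear (fun h => l h + l' h).
Proof. by move=> L L' c u v; rewrite L L' scalerDr addrACA. Qed.

Lemma tlinear_mulr p q s (l : mtuple F g n -> 'M[C]_(p, q)) (M : 'M_(q, s)) :
  tlinear l -> tlinear (fun h => l h *m M).
Proof. by move=> L c u v; rewrite L mulmxDl scalemxAl. Qed.

Lemma tlinear_mull p q s (l : mtuple F g n -> 'M[C]_(p, q)) (M : 'M_(s, p)) :
  tlinear l -> tlinear (fun h => M *m l h).
Proof. by move=> L c u v; rewrite L mulmxDr scalemxAr. Qed.

Lemma mlin_cons p q s k (l : mtuple F g n -> 'M[C]_(p, q))
    (a : ('I_k -> mtuple F g n) -> 'M[C]_(q, s)) :
    (forall h h', h =1 h' -> a h = a h') ->
  tlinear l -> mlin a ->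
  mlin (fun h : 'I_k.+1 -> _ => l (h ord0) *m a (fun i => h (lift ord0 i))).
Proof.
move=> aext L ma h i c u v upd.
case: (unliftP ord0 i) => [j|] ij; rewrite {}ij in upd *.
  have upd0 x : upd x ord0 = h ord0 by rewrite /upd dfwithout.
  have updS x : a (fun i => upd x (lift ord0 i)) =
      a (@dfwith _ (fun=> mtuple F g n) (fun i => h (lift ord0 i)) j x).
    apply: aext => i'; rewrite /upd; have [<-|ji] := eqVneq j i'.
      by rewrite !dfwithin.
    by rewrite !dfwithout // (inj_eq lift_inj).
  by rewrite !upd0 !updS ma mulmxDr scalemxAr.
have upd0 x : upd x ord0 = x by rewrite /upd dfwithin.
have updS x : a (fun i => upd x (lift ord0 i)) = a (fun i => h (lift ord0 i)).
  by apply: aext => i'; rewrite /upd dfwithout.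
by rewrite !upd0 !updS L mulmxDl scalemxAl.
Qed.

Lemma mlin_prod p k (l : mtuple F g n -> 'M[C]_p) : tlinear l ->
  mlin (fun h : 'I_k -> _ => \prod_i l (h i)).
Proof.
move=> L; elim: k => [|k IH]; first by move=> h [].
have := mlin_cons _ L IH; rewrite /mlin => m h i c u v; rewrite /= !big_ord_recl.
by apply: m => h1 h2 e; apply: eq_bigr => j _; rewrite e.
Qed.

End Multilinear.

(** Write M for the inverse of I - Lambda_Xi(X), K(H) = Lambda_Xi(H) M,
    L0(H) = (H + p(X) Lambda_Xi(H)) M and delta = p(X + H) - p(X).  Subtracting
    the equations p(X) (I - Lambda_Xi(X)) = X and the one at X + H gives
    delta (I - K(H)) = L0(H).  The power series is therefore
    p(X + H) = p(X) + sum_k L0(H) K(H)^k, and its remainder after m terms of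
    the sum is delta K(H)^m. *)
Section Expansion.
Variables (g n : nat) (Xi : mtuple F g g) (X : mtuple F g n).
Hypothesis dX : cvx_dom Xi X.

Let M := invmx (1%:M - Lambda Xi X).
Let p := rowblk (cvx_map Xi X).
Let K (H : mtuple F g n) := Lambda Xi H *m M.
Let L0 (H : mtuple F g n) := (rowblk H + p *m Lambda Xi H) *m M.

Let contractK (r : C) := forall H : mtuple F g n, tsmall r H -> sumnorm (K H) <= 2^-1.

Let small_radius : exists2 r : C, 0 < r & contractK r.
Proof.
pose k := (\sum_j sumnorm (Xi j)) * (n * n)%:R * sumnorm M.
have k0 : 0 <= k by rewrite !mulr_ge0 // sumr_ge0.
(* ||K(H)|| <= k r on the polydisc of radius r; the summand 1 covers k = 0. *)
exists (2 * (k + 1))^-1 => [|H /(ler_sumnorm_Lambda Xi) HH].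
  by rewrite invr_gt0 mulr_gt0 // ltr_wpDl.
rewrite (le_trans (ler_sumnormM _ _)) //.
rewrite (le_trans (ler_wpM2r (sumnorm_ge0 M) HH)) //.
have k1 : 0 < k + 1 by rewrite ltr_wpDl.
rewrite mulrA mulrAC -/k gtr0_norm ?invr_gt0 ?mulr_gt0 //.
by rewrite ler_pdivrMr ?mulr_gt0 // mulKf ?pnatr_eq0 // lerDl.
Qed.

Let pencilM H : (1%:M - Lambda Xi (tadd X H)) *m M = 1%:M - K H.
Proof. by rewrite LambdaD opprD addrA mulmxBl mulmxV. Qed.

Let dom_near r H : contractK r -> tsmall r H -> cvx_dom Xi (tadd X H).
Proof.
move=> cK /cK HK; suff : 1%:M - K H \in unitmx.
  by rewrite -pencilM unitmx_mul => /andP[].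
apply: kermx_unitmx => v; rewrite mulmxBr mulmx1 => /eqP; rewrite subr_eq0.
by move=> /eqP; apply: contract_fixed.
Qed.

Lemma cvx_dom_open : exists2 r : C, 0 < r &
  forall H, tsmall r H -> cvx_dom Xi (tadd X H).
Proof.
by have [r r0 rK] := small_radius; exists r => // H; apply: dom_near.
Qed.

Let delta H := rowblk (cvx_map Xi (tadd X H)) - p.

Let deltaE H : cvx_dom Xi (tadd X H) -> delta H *m (1%:M - K H) = L0 H.
Proof.
move=> dXH; rewrite -pencilM mulmxA mulmxBl; congr (_ *m _).
rewrite rowblk_cvx_map mulmxKV // LambdaD opprD addrA mulmxBr.
rewrite /p {1}rowblk_cvx_map mulmxKV //.
have -> : rowblk (tadd X H) = rowblk X + rowblk H.
  by apply/matrixP=> a u; rewrite !mxE.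
by rewrite opprB addrC addrA subrK addrC.
Qed.

Let term i k : ('I_k -> mtuple F g n) -> 'M[C]_n :=
  match k with
  | 0 => fun=> blk p i
  | k'.+1 => fun h => blk (L0 (h ord0) *m \prod_j K (h (lift ord0 j))) i
  end.

Let tlinear_K : tlinear K.
Proof. exact/tlinear_mulr/tlinear_Lambda. Qed.

Let tlinear_L0 : tlinear L0.
Proof.
apply/tlinear_mulr/tlinear_add; first exact: tlinear_rowblk.
exact/tlinear_mull/tlinear_Lambda.
Qed.

Let term_multilinear i k : multilinear (@term i k).
Proof.
case: k => [|k] h; first by case.
move=> j c u v /=.
have /= -> := (mlin_cons _ tlinear_L0 (@mlin_prod g n _ k K tlinear_K)).
  by apply/matrixP=> a b; rewrite !mxE.
by move=> h1 h2 e; apply: eq_bigr => l _; rewrite e.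
Qed.

Let partial_sum i H m : cvx_dom Xi (tadd X H) ->
  \sum_(k < m.+1) @term i k (fun=> H) =
  cvx_map Xi (tadd X H) i - blk (delta H *m K H ^+ m) i.
Proof.
move=> dXH; elim: m => [|m IH].
  rewrite big_ord1 /= expr0 mulmx1.
  by apply/matrixP=> a b; rewrite !mxE mxtens_indexK opprB addrC subrK.
rewrite big_ord_recr IH /= prodr_const card_ord -deltaE // -mulmxA.
rewrite (mulmxBl 1%:M) mul1mx mulmxBr -[K H *m _]/(K H * K H ^+ m) -exprS.
by apply/matrixP=> a b; rewrite !mxE addrA subrK.
Qed.

Lemma cvx_map_analytic i : analytic_at (fun Y => cvx_map Xi Y i) X.
Proof.
have [r r0 rK] := small_radius.
pose b := (g%:R * ((n * n)%:R * r) + sumnorm p *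
  ((\sum_j sumnorm (Xi j)) * ((n * n)%:R * r))) * sumnorm M.
have L0b H : tsmall r H -> sumnorm (L0 H) <= b.
  move=> Hr; rewrite (le_trans (ler_sumnormM _ _)) // ler_wpM2r //.
  have rr : r = `|r| by rewrite gtr0_norm.
  rewrite (le_trans (ler_sumnormD _ _)) // rr lerD ?ler_sumnorm_rowblk //.
  rewrite (le_trans (ler_sumnormM _ _)) // ler_wpM2l //.
  exact: ler_sumnorm_Lambda.
have b0 : 0 <= b.
  have s0 : 0 <= \sum_j sumnorm (Xi j) by apply: sumr_ge0.
  by rewrite mulr_ge0 // addr_ge0 // !mulr_ge0 // ltW.
exists r, (sumnorm p + b), (term i); split => //.
- move=> [|k] h hr u v /=; rewrite mxE.
    by rewrite (le_trans (ler_entry_sumnorm _ _ _)) // lerDl.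
  rewrite (le_trans (ler_entry_sumnorm _ _ _)) //.
  rewrite (le_trans (ler_sumnorm_prod _ _)) => // [j|].
    by rewrite (le_trans (rK _ (hr _))) // invf_le1 // ler1n.
  by rewrite (le_trans (L0b _ (hr _))) // lerDr.
move=> H Hr u v; have dXH := dom_near rK Hr.
(* The remainder delta K(H)^m is geometric because ||K(H)|| <= 1/2. *)
apply: (@cvg_geometric_error _ _ (sumnorm (delta H))) => m.
rewrite -summxE partial_sum // 3!mxE opprB addrC subrK.
rewrite (le_trans (ler_entry_sumnorm _ _ _)) // ler_sumnorm_exp //.
exact: rK.
Qed.

End Expansion.

(** * Convexotonic maps are free analytic *)

Section FreeAnalytic.
Local Open Scope sesquilinear_scope.
Variables (g : nat) (Xi : mtuple F g g).

(** If X G = G Y, then p(X) G and G p(Y) both solve the equation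
    z = G Y + z o Y, whose solution is unique for Y in the domain. *)
Lemma cvx_map_intertwine : respects_intertwinings (cvx_dom Xi) (cvx_map Xi).
Proof.
move=> m n X Y G dX dY XGY i.
suff e : rowblk (fun s => cvx_map Xi X s *m G) = G *m rowblk (cvx_map Xi Y).
  by move: e; rewrite mul_rowblk => /(congr1 (fun V => blk V i)); rewrite !rowblkK.
rewrite rowblk_cvx_map mulmxA; apply: (canRL (mulmxK dY)).
rewrite mul_rowblk; apply: rowblk_quasi => s.
rewrite {1}cvx_map_circ // mulmxDl XGY; congr (_ + _).
rewrite mulmx_suml; apply: eq_bigr => k _; rewrite mulmx_suml.
by apply: eq_bigr => j _; rewrite -scalemxAl -!mulmxA XGY.
Qed.

Hypothesis XX : convexotonic Xi.

Lemma cvx_dom_free : free_set (cvx_dom Xi).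
Proof.
split=> [m n X Y dX dY|n U X /unitarymxP UU dX].
  apply: (cvx_dom_quasi (y := tdsum (cvx_map Xi X) (cvx_map Xi Y))) => // s.
  have -> : circ Xi (tdsum (cvx_map Xi X) (cvx_map Xi Y)) (tdsum X Y) s =
      block_mx (circ Xi (cvx_map Xi X) X s) 0 0 (circ Xi (cvx_map Xi Y) Y s).
    rewrite -sum_block_diag; apply: eq_bigr => k _.
    rewrite -sum_block_diag; apply: eq_bigr => j _.
    rewrite mulmx_block !(mulmx0, mul0mx, addr0, add0r).
    by rewrite scale_block_mx !scaler0.
  by rewrite add_block_mx !addr0 {1}/tdsum -!cvx_map_circ.
apply: (cvx_dom_quasi (y := fun s => U^t* *m cvx_map Xi X s *m U)) => // s.
rewrite cvx_map_circ // mulmxDr mulmxDl; congr (_ + _).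
rewrite mulmx_sumr mulmx_suml; apply: eq_bigr => k _.
rewrite mulmx_sumr mulmx_suml; apply: eq_bigr => j _.
rewrite -scalemxAr -scalemxAl; congr (_ *: _).
by rewrite !mulmxA -[in RHS](mulmxA _ U) UU mulmx1.
Qed.

Lemma cvx_map_free_analytic : free_analytic (cvx_dom Xi) (cvx_map Xi).
Proof.
split; [exact: cvx_dom_free| |exact: cvx_map_intertwine|].
  by move=> n X; apply: cvx_dom_open.
by move=> n X dX i; apply: cvx_map_analytic.
Qed.

End FreeAnalytic.

End Analytic.

(** * Congruence of linear pencils *)

Section Adjoint.
Local Open Scope sesquilinear_scope.
Variable K : numClosedFieldType.

Lemma adjmxM m n p (A : 'M[K]_(m, n)) (B : 'M_(n, p)) :
  (A *m B)^t* = B^t* *m A^t*.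
Proof. by rewrite trmx_mul map_mxM. Qed.

Lemma adjmxD m n (A B : 'M[K]_(m, n)) : (A + B)^t* = A^t* + B^t*.
Proof. by rewrite linearD map_mxD. Qed.

Lemma adjmxB m n (A B : 'M[K]_(m, n)) : (A - B)^t* = A^t* - B^t*.
Proof. by rewrite linearB map_mxB. Qed.

Lemma adjmx1 n : (1%:M : 'M[K]_n)^t* = 1%:M.
Proof. by rewrite trmx1 map_mx1. Qed.

Lemma adjmxZ m n c (A : 'M[K]_(m, n)) : (c *: A)^t* = c^* *: A^t*.
Proof. by rewrite linearZ map_mxZ. Qed.

Lemma adjmx_tens m n p q (A : 'M[K]_(m, n)) (B : 'M[K]_(p, q)) :
  (A *t B)^t* = A^t* *t B^t*.
Proof. by rewrite trmx_tens map_mxT. Qed.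

(** Put W = N + Z = I + T.  Then the right-hand side is the Gram matrix of W
    minus that of Z, and the latter is the Gram matrix of T. *)
Lemma pencil_split n (T Z : 'M[K]_n) : Z^t* *m Z = T^t* *m T ->
  let N := 1%:M - (Z - T) in
  1%:M + T + T^t* = N^t* *m N + N^t* *m Z + Z^t* *m N.
Proof.
move=> ZT N; have NZ : N + Z = 1%:M + T by rewrite /N opprB addrA subrK.
rewrite -mulmxDr NZ -[N](addrK Z) NZ adjmxB mulmxBl mulmxBr ZT addrA subrK.
by rewrite adjmxD adjmx1 mulmxDl mul1mx mulmxDr mulmx1 addrA addrK.
Qed.

Lemma pencil_split_ker n (T Z : 'M[K]_n) (v : 'cV_n) :
    Z^t* *m Z = T^t* *m T -> (1%:M - (Z - T)) *m v = 0 ->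
  (v^t* *m (1%:M + T + T^t*) *m v) 0 0 = 0.
Proof.
move=> /pencil_split /= ->; move: (1%:M - _) => N Nv.
rewrite !(mulmxDl, mulmxDr) -!mulmxA Nv !mulmx0 addr0 add0r.
by rewrite !mulmxA -adjmxM Nv trmx0 map_mx0 !mul0mx mxE.
Qed.

(** Multiplying out with S N = Z turns the left-hand side into the expression
    of [pencil_split]. *)
Lemma pencil_congr n (T Z S : 'M[K]_n) : Z^t* *m Z = T^t* *m T ->
  let N := 1%:M - (Z - T) in
  S *m N = Z -> N^t* *m (1%:M + S + S^t*) *m N = 1%:M + T + T^t*.
Proof.
move=> ZT /= SN; rewrite (pencil_split ZT) /=; move: (1%:M - _) SN => N SN.
rewrite !mulmxDr mulmx1 !mulmxDl.
by rewrite -[N^t* *m S *m N]mulmxA SN -[N^t* *m S^t*]adjmxM SN.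
Qed.

Lemma adjmx_self_gt0 n (v : 'cV[K]_n) : v != 0 -> 0 < (v^t* *m v) 0 0.
Proof.
case/cV0Pn=> i vi; rewrite mxE (bigD1 i) //= !mxE ltr_wpDr //.
  by apply: sumr_ge0 => j _; rewrite !mxE mulrC mul_conjC_ge0.
by rewrite mulrC mul_conjC_gt0.
Qed.

End Adjoint.

Section PosDef.
Local Open Scope sesquilinear_scope.
Variable F : realType.
Local Notation C := (cplx F).

Let congrE n (N M : 'M[C]_n) (v : 'cV_n) :
  (N *m v)^t* *m M *m (N *m v) = v^t* *m (N^t* *m M *m N) *m v.
Proof. by rewrite adjmxM !mulmxA. Qed.

Lemma psdmx_congr n (N M : 'M[C]_n) :
  N \in unitmx -> psdmx (N^t* *m M *m N) -> psdmx M.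
Proof. by move=> uN P v; rewrite -(mulKVmx uN v) congrE; apply: P. Qed.

Lemma posdefmx_congr n (N M : 'M[C]_n) :
  N \in unitmx -> posdefmx (N^t* *m M *m N) -> posdefmx M.
Proof.
move=> uN P v v0; rewrite -(mulKVmx uN v) congrE; apply: P.
by apply: contraNneq v0 => e; rewrite -(mulKVmx uN v) e mulmx0.
Qed.

Lemma posdefmx_psd n (M : 'M[C]_n) : posdefmx M -> psdmx M.
Proof.
move=> P v; have [->|v0] := eqVneq v 0; last exact/ltW/P.
by rewrite mulmx0 mxE.
Qed.

Lemma posdefmx_shift n (s t : C) (M : 'M[C]_n) :
  0 < s -> 0 <= t -> psdmx M -> posdefmx (s%:M + t *: M).
Proof.
move=> s0 t0 P v v0; rewrite mulmxDr mulmxDl mul_mx_scalar -scalemxAl.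
rewrite -scalemxAr -scalemxAl mxE [X in X + _]mxE [X in _ + X]mxE.
by rewrite ltr_wpDr ?mulr_ge0 ?P // mulr_gt0 ?adjmx_self_gt0.
Qed.

End PosDef.

(** * Spectrahedral pairs *)

Section SpectrahedralPair.
Local Open Scope sesquilinear_scope.
Variable F : realType.
Local Notation C := (cplx F).

(** The data are kept in a form that is symmetric under the exchange of A and
    B = CA: R_j is written as B_j - A_j and not as (C - I) A_j. *)
Record spair g d (Cm : 'M[C]_d) (A B R : mtuple F g d) (Xi : mtuple F g g) :
    Prop := SPair {
  sp_unitary : Cm \is unitarymx;
  sp_rotation : forall j, B j = Cm *m A j;
  sp_diff : forall j, R j = B j - A j;
  sp_free : forall c : 'I_g -> C, \sum_j c j *: R j = 0 -> forall j, c j = 0;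
  sp_algebra : forall j k, R k *m R j = \sum_s Xi j k s *: R s;
  sp_module : forall j k, A k *m R j = \sum_s Xi j k s *: A s
}.

Lemma spair_module_r g d Cm (A B R : mtuple F g d) (Xi : mtuple F g g) :
  spair Cm A B R Xi -> forall j k, B k *m R j = \sum_s Xi j k s *: B s.
Proof.
move=> P j k; rewrite (sp_rotation P) -mulmxA (sp_module P) mulmx_sumr.
by apply: eq_bigr => s _; rewrite -scalemxAr (sp_rotation P).
Qed.

(** The inverse of the convexotonic map of Xi is the one of -Xi, so this
    symmetry transfers every statement about p to its inverse. *)
Lemma spairC g d Cm (A B R : mtuple F g d) (Xi : mtuple F g g) :
  spair Cm A B R Xi ->
  spair (Cm^t*) B A (fun j => - R j) (fun j => - Xi j).
Proof.
move=> P; have P' := spair_module_r P; case: P => uC AB RE fR sR sA.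
have neg j k (S : mtuple F g d) (M : 'M[C]_d) :
    M = \sum_s Xi j k s *: S s -> - M = \sum_s (- Xi j) k s *: S s.
  by move=> ->; rewrite -sumrN; apply: eq_bigr => s _; rewrite mxE scaleNr.
split=> [|j|j|c c0 j|j k|j k].
- by rewrite trmxC_unitary.
- by rewrite AB -(invmx_unitary uC) mulKmx // unitarymx_unit.
- by rewrite RE opprB.
- apply: fR; apply: oppr_inj; rewrite -sumrN oppr0 -[RHS]c0.
  by apply: eq_bigr => i _; rewrite scalerN.
- rewrite mulNmx mulmxN opprK sR.
  by apply: eq_bigr => s _; rewrite mxE scaleNr scalerN opprK.
- by rewrite mulmxN; apply: neg; apply: P'.
Qed.

Section Pair.
Variables (g d : nat) (Cm : 'M[C]_d) (A B R : mtuple F g d) (Xi : mtuple F g g).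
Hypothesis P : spair Cm A B R Xi.

(** Compare the coordinates of (R_a R_k) R_j and R_a (R_k R_j). *)
Lemma spair_convexotonic : convexotonic Xi.
Proof.
move=> j k; apply/matrixP=> a t; rewrite summxE.
apply/eqP; rewrite -subr_eq0; apply/eqP.
pose c t := (Xi k *m Xi j) a t - \sum_s (Xi j k s *: Xi s) a t.
apply: (sp_free P (c := c)) => {t}.
under eq_bigr do rewrite scalerBl.
rewrite big_split sumrN /=; apply/eqP; rewrite subr_eq0; apply/eqP.
transitivity (R a *m R k *m R j); last first.
  rewrite -mulmxA (sp_algebra P) mulmx_sumr.
  under [LHS]eq_bigr do rewrite -scalemxAr (sp_algebra P) scaler_sumr.
  rewrite exchange_big; apply: eq_bigr => s _.
  by rewrite scaler_suml; apply: eq_bigr => t _; rewrite mxE scalerA.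
rewrite (sp_algebra P) mulmx_suml.
under [RHS]eq_bigr do rewrite -scalemxAl (sp_algebra P) scaler_sumr.
rewrite [RHS]exchange_big; apply: eq_bigr => s _.
by rewrite mxE scaler_suml; apply: eq_bigr => t _; rewrite scalerA.
Qed.

Section Level.
Variables (n : nat) (X : mtuple F g n).
Let N := 1%:M - Lambda R X.

Let NE : N = 1%:M - (Lambda B X - Lambda A X).
Proof.
congr (_ - _); rewrite -sumrB; apply: eq_bigr => j _.
by apply/matrixP=> u v; rewrite (sp_diff P) !mxE mulrBl.
Qed.

Let isoAB : (Lambda B X)^t* *m Lambda B X = (Lambda A X)^t* *m Lambda A X.
Proof.
have -> : Lambda B X = (Cm *t 1%:M) *m Lambda A X.
  rewrite mulmx_sumr; apply: eq_bigr => j _.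
  by rewrite tensmx_mul mul1mx (sp_rotation P).
rewrite adjmxM -mulmxA (mulmxA _ (Cm *t _)) adjmx_tens tensmx_mul adjmx1 mulmx1.
have /unitarymxP/mulmx1C -> := sp_unitary P.
by rewrite tensmx11 mul1mx.
Qed.

Lemma spair_resolvent : cvx_dom Xi X -> N \in unitmx.
Proof.
move=> dX; case/mulmx1_unit: (quasi_inverse (sp_algebra P) (fun s => cvx_map_circ s dX)).
by [].
Qed.

Lemma spair_pencil : cvx_dom Xi X ->
  N^t* *m Lpencil B (cvx_map Xi X) *m N = Lpencil A X.
Proof.
move=> dX; rewrite NE; apply: pencil_congr => //; rewrite -NE.
exact: (Lambda_quasi (spair_module_r P) (fun s => cvx_map_circ s dX)).
Qed.

(** A left null vector v of I - Lambda_Xi(X) satisfies y = y o X for the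
    tuple y all of whose rows are given by v.  Then Lambda_R(y) N = 0, and
    y = 0 follows from the linear independence of the R_j. *)
Lemma spair_cvx_dom : N \in unitmx -> cvx_dom Xi X.
Proof.
move=> uN; apply: kermx_unitmx => v vX.
pose y := blk (const_mx 1 *m v : 'M[C]_(n, g * n)).
have rowy : rowblk y = const_mx 1 *m v by rewrite blkK.
have yX s : y s = circ Xi y X s.
  rewrite -[RHS]rowblkK -rowblk_mul rowy; congr (blk _ s).
  apply/eqP; rewrite -subr_eq0 -{1}[const_mx 1 *m v]mulmx1 -mulmxBr -mulmxA vX.
  by rewrite mulmx0.
have Ry : Lambda R y = 0.
  rewrite -(mulmxK uN (Lambda R y)) mulmxBr mulmx1 (Lambda_circ _ _ (sp_algebra P)).
  by rewrite (eq_Lambda (frefl R) yX) subrr mul0mx.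
apply/matrixP=> z u; rewrite ord1 mxE; case: (mxtens_indexP u) => j b.
(* All rows of y j agree, so the diagonal entry is the entry of v at (j, b). *)
have : y j b b = 0.
  apply: (sp_free P (c := fun j => y j b b)); apply/matrixP=> a a'.
  have /matrixP /(_ (mxtens_index (a, b)) (mxtens_index (a', b))) := Ry.
  rewrite !mxE summxE => <-; rewrite summxE; apply: eq_bigr => i _.
  by rewrite tensmxE !mxE mulrC.
by rewrite !mxE big_ord1 mxE mul1r.
Qed.

Lemma posdef_cvx_dom : posdefmx (Lpencil A X) -> cvx_dom Xi X.
Proof.
move=> PA; apply: spair_cvx_dom; rewrite -unitmx_tr; apply: kermx_unitmx => w wN.
apply/eqP; rewrite -trmx_eq0; apply/negPn/negP => /PA.
rewrite (pencil_split_ker isoAB) ?ltxx // -NE.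
by rewrite -[N]trmxK -trmx_mul wN trmx0.
Qed.

End Level.

Lemma spair_psd n (X : mtuple F g n) : cvx_dom Xi X ->
  psdmx (Lpencil A X) -> psdmx (Lpencil B (cvx_map Xi X)).
Proof.
move=> dX PA; apply: (psdmx_congr (spair_resolvent dX)).
by rewrite (spair_pencil dX).
Qed.

Lemma spair_posdef n (X : mtuple F g n) : cvx_dom Xi X ->
  posdefmx (Lpencil A X) -> posdefmx (Lpencil B (cvx_map Xi X)).
Proof.
move=> dX PA; apply: (posdefmx_congr (spair_resolvent dX)).
by rewrite (spair_pencil dX).
Qed.

(** If v (I - Lambda_R(X)) = 0 and t = 1 - s with 0 < s <= 1, then t X lies in
    the interior, and the resolvent identity for t X reads
    v = s v (I + Lambda_R(p(t X))).  As p(t X) lies in the bounded spectrahedron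
    of B, the factor on the right has norm at most 1/2 for small s, so
    v = 0. *)
Lemma bounded_cvx_dom n (X : mtuple F g n) :
  levelwise_bounded (free_spectrahedron B) ->
  psdmx (Lpencil A X) -> cvx_dom Xi X.
Proof.
move=> /(_ n) [r Br] PX; apply: spair_cvx_dom; apply: kermx_unitmx => v vX.
pose b := sumnorm (1%:M : 'M[C]_(d * n)) +
  (\sum_j sumnorm (R j)) * ((n * n)%:R * `|r|).
have b0 : 0 <= b by rewrite addr_ge0 // mulr_ge0 ?sumr_ge0 // mulr_ge0.
have b1 : 0 < b + 1 by rewrite ltr_wpDl.
pose s := (2 * (b + 1))^-1; pose t := 1 - s.
have s0 : 0 < s by rewrite invr_gt0 mulr_gt0.
have s_half : s * b <= 2^-1.
  by rewrite mulrC ler_pdivrMr ?mulr_gt0 // mulKf ?pnatr_eq0 // lerDl.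
have t0 : 0 <= t.
  by rewrite subr_ge0 invf_le1 ?mulr_gt0 // mulrDr mulr1 -[leLHS]add0r lerD ?mulr_ge0 // ler1n.
have tR : t^* = t by apply/CrealP/ger0_real.
pose Y := tscale t X.
have PY : posdefmx (Lpencil A Y).
  suff -> : Lpencil A Y = s%:M + t *: Lpencil A X by apply: posdefmx_shift.
  rewrite /Lpencil LambdaZ adjmxZ tR !scalerDr scalemx1 !addrA.
  by congr (_ + _ + _); rewrite -raddfD /= addrC subrK.
have dY := posdef_cvx_dom PY.
have pY := Br _ (spair_psd dY (posdefmx_psd PY)).
(* The resolvent is needed as a right factor, hence the exchange of factors. *)
have inv := mulmx1C (quasi_inverse (sp_algebra P) (fun j => cvx_map_circ j dY)).
apply: (@contract_fixed _ _ _ v (s *: (1%:M + Lambda R (cvx_map Xi Y)))).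
  rewrite sumnormZ gtr0_norm // (le_trans _ s_half) // ler_pM2l //.
  by rewrite (le_trans (ler_sumnormD _ _)) // lerD2l ler_sumnorm_Lambda.
rewrite -scalemxAr scalemxAl.
suff <- : v *m (1%:M - Lambda R Y) = s *: v by rewrite -mulmxA inv mulmx1.
move/eqP: vX; rewrite mulmxBr mulmx1 subr_eq0 => /eqP vX.
by rewrite LambdaZ mulmxBr mulmx1 -scalemxAr -vX -{1}[v]scale1r -scalerBl subKr.
Qed.

Lemma spair_bianalytic (D E : levels F g) :
    (forall n (X : mtuple F g n), D n X ->
       cvx_dom Xi X /\ E n (cvx_map Xi X)) ->
    (forall n (Y : mtuple F g n), E n Y ->
       cvx_dom (fun j => - Xi j) Y /\ D n (cvx_map (fun j => - Xi j) Y)) ->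
  bianalytic_under D E (cvx_dom Xi) (cvx_map Xi).
Proof.
have XX := spair_convexotonic; have XXN := convexotonicN XX.
move=> DE ED; split; [exact: cvx_map_free_analytic|exact: DE|].
exists (cvx_dom (fun j => - Xi j)), (cvx_map (fun j => - Xi j)); split.
- exact: cvx_map_free_analytic.
- exact: ED.
- move=> n Y /ED [dY _]; apply/funext => s.
  have := cvx_mapK XXN dY s.
  by have -> : (fun j => - - Xi j) = Xi by apply/funext => j; rewrite opprK.
- by move=> n X /DE [dX _]; apply/funext => s; apply: cvx_mapK.
Qed.

End Pair.
End SpectrahedralPair.

Theorem theorem1p1 (F : realType) (d g : nat)
    (calR : {vspace 'M[cplx F]_d}) (R : mtuple F g d)
    (Xi : mtuple F g g) (C : 'M[cplx F]_d) (A : mtuple F g d)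
    (calR_algebra : forall S T : 'M[cplx F]_d,
       S \in calR -> T \in calR -> S *m T \in calR)
    (R_basis : basis_of calR [tuple R j | j < g])
    (Xi_structure : forall j k, R k *m R j = \sum_s Xi j k s *: R s)
    (C_unitary : C \is unitarymx)
    (R_def : forall j, R j = (C - 1%:M) *m A j)
    (A_module : forall j k, A k *m R j = \sum_s Xi j k s *: A s) :
  let CA : mtuple F g d := fun j => C *m A j in
  let nXi : mtuple F g g := fun j => - Xi j in
  [/\ convexotonic Xi,
      bianalytic_under
        (levelsI (free_spectrahedron A) (cvx_dom Xi))
        (levelsI (free_spectrahedron CA) (cvx_dom nXi))
        (cvx_dom Xi) (cvx_map Xi),
      bianalytic_under (free_spectrahedron_int A) (free_spectrahedron_int CA)
        (cvx_dom Xi) (cvx_map Xi)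
    & levelwise_bounded (free_spectrahedron A) ->
      levelwise_bounded (free_spectrahedron CA) ->
      bianalytic_under (free_spectrahedron A) (free_spectrahedron CA)
        (cvx_dom Xi) (cvx_map Xi)].
Proof.
move=> CA nXi.
have P : spair C A CA R Xi.
  split=> // [j|c c0 j]; first by rewrite R_def mulmxBl mul1mx.
  have /freeP fR := basis_free R_basis; apply: fR; rewrite -[RHS]c0.
  by apply: eq_bigr => i _; rewrite nth_mktuple.
have Q := spairC P.
have XX := spair_convexotonic P; have XXN := convexotonicN XX.
have dom2 n (Y : mtuple F g n) : cvx_dom nXi Y -> cvx_dom Xi (cvx_map nXi Y).
  move=> dY; have := cvx_map_dom XXN dY.
  by have -> : (fun j => - nXi j) = Xi by apply/funext => j; rewrite opprK.
split; first exact: XX.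
- apply: (spair_bianalytic P) => n X [LX dX]; (split; first exact: dX); split.
  + exact: (spair_psd P dX LX).
  + exact: (cvx_map_dom XX dX).
  + exact: (spair_psd Q dX LX).
  + exact: (dom2 _ _ dX).
- apply: (spair_bianalytic P) => n X LX.
  + have dX := posdef_cvx_dom P LX.
    by split; [exact: dX | exact: (spair_posdef P dX LX)].
  + have dX := posdef_cvx_dom Q LX.
    by split; [exact: dX | exact: (spair_posdef Q dX LX)].
move=> bA bCA; apply: (spair_bianalytic P) => n X LX.
- have dX := bounded_cvx_dom P bCA LX.
  by split; [exact: dX | exact: (spair_psd P dX LX)].
- have dX := bounded_cvx_dom Q bA LX.
  by split; [exact: dX | exact: (spair_psd Q dX LX)].
Qed.
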